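(* Every consistent atomic RCC8 network over $\{\mathbf{PO},\mathbf{TPP},\mathbf{TPP}^{-1},\mathbf{NTPP},\mathbf{NTPP}^{-1}\}$ has a convex solution in $\mathbb{R}^2$.
   Context: A region in $\mathbb{R}^n$ ($n\geq 1$) is a nonempty regular closed subset $X$, i.e. $X=\mathrm{cl}(\mathrm{int}(X))$; write $i(X)$ for the interior. The eight RCC8 base relations between regions $a,b$ (jointly exhaustive and pairwise disjoint; $\subset$ denotes proper inclusion) are: $a\,\mathbf{EQ}\,b$: $a=b$; $a\,\mathbf{DC}\,b$: $a\cap b=\emptyset$; $a\,\mathbf{EC}\,b$: $a\cap b\neq\emptyset$ and $i(a)\cap i(b)=\emptyset$; $a\,\mathbf{PO}\,b$: $i(a)\cap i(b)\neq\emptyset$, $a\not\subseteq b$, $b\not\subseteq a$; $a\,\mathbf{TPP}\,b$: $a\subset b$ and $a\not\subset i(b)$; $a\,\mathbf{NTPP}\,b$: $a\subset i(b)$; and the converses $\mathbf{TPP}^{-1}$, $\mathbf{NTPP}^{-1}$ of the last two. Let $V$ be a finite set of variables. An RCC8 constraint is an expression $u\,R\,v$ with $u,v\in V$ and $R$ a nonempty set of base relations; an RCC8 network is a set of such constraints. It is atomic if for every pair of distinct variables $u,v$ it contains a constraint $u\,R\,v$ or $v\,R\,u$ with $R$ a singleton. It is a network over a set $\mathcal{R}$ of base relations if every constraint $u\,R\,v$ in it has $R\subseteq\mathcal{R}$. An $n$-dimensional solution (solution in $\mathbb{R}^n$) of a network is a map $\mathcal{S}$ from $V$ to regions of $\mathbb{R}^n$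 such that for each constraint $u\,R\,v$ the base relation holding between $\mathcal{S}(u)$ and $\mathcal{S}(v)$ belongs to $R$. A network is consistent if it has a solution in $\mathbb{R}^n$ for some $n\geq 1$ (the regions need not be convex or connected). A solution is convex if every $\mathcal{S}(v)$ is a convex set. *)

(* Defs.v *)
From HB Require Import structures.
From mathcomp Require Import all_boot all_order all_algebra.
From mathcomp Require Import boolp classical_sets reals topology normedtype.
From mathcomp Require Import convex.

Set Implicit Arguments.
Unset Strict Implicit.
Unset Printing Implicit Defensive.

Import numFieldNormedType.Exports.

Local Open Scope classical_set_scope.
Local Open Scope ring_scope.

(* MathComp-Analysis. R^n is 'rV[R]_n for R : realType: its topology is induced
   by the sup norm, hence is the Euclidean one. *)

Definition region (T : topologicalType) (X : set T) : Prop :=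
  X !=set0 /\ X = closure (interior X).

Inductive rcc8 : Type := EQ | DC | EC | PO | TPP | NTPP | TPPi | NTPPi.

Section relations.
Variable T : topologicalType.
Implicit Types a b : set T.

Definition tpp a b : Prop := a `<` b /\ ~ (a `<` interior b).

(* The inclusion is proper: for b = setT this excludes a = b. *)
Definition ntpp a b : Prop := a `<` interior b.

Definition rcc8_holds (r : rcc8) a b : Prop :=
  match r with
  | EQ => a = b
  | DC => a `&` b = set0
  | EC => a `&` b !=set0 /\ interior a `&` interior b = set0
  | PO => [/\ interior a `&` interior b !=set0, ~ (a `<=` b) & ~ (b `<=` a)]
  | TPP => tpp a b
  | NTPP => ntpp a b
  | TPPi => tpp b a
  | NTPPi => ntpp b a
  end.

End relations.

Record constraint (V : finType) : Type := Constraint {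
  lhs : V;
  rels : set rcc8;
  rhs : V;
  rels_neq0 : rels !=set0
}.

Definition network (V : finType) : Type := set (constraint V).

Section networks.
Variable V : finType.
Implicit Types (N : network V) (c : constraint V).

Definition atomic N : Prop :=
  forall u v : V, u <> v ->
  exists c, [/\ N c,
    (lhs c = u /\ rhs c = v) \/ (lhs c = v /\ rhs c = u) &
    exists r : rcc8, rels c = [set r]].

Definition network_over (B : set rcc8) N : Prop :=
  forall c, N c -> rels c `<=` B.

(* The base relations are jointly exhaustive and pairwise disjoint on regions,
   so the r below is the base relation holding between S (lhs c) and
   S (rhs c). *)
Definition solution (R : realType) (n : nat) N (S : V -> set 'rV[R]_n) : Prop :=
  (forall v, region (S v)) /\
  (forall c, N c ->
    exists2 r, rels c r & rcc8_holds r (S (lhs c)) (S (rhs c))).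

Definition consistent (R : realType) N : Prop :=
  exists n : nat, (1 <= n)%N /\
  exists S : V -> set 'rV[R]_n, solution N S.

Definition convex_solution (R : realType) (n : nat) N
    (S : V -> set 'rV[R]_n) : Prop :=
  solution N S /\ forall v, convex_set (S v).

End networks.

(* Main.v *)
(** In a solution [S] of the network, [S u `<=` S v] and [S u `<` interior (S v)]
    define a preorder on the variables and a strict relation absorbing it on both sides.
    To realise both by convex regions of the plane, choose points [t a] of the real line,
    one per variable, and let the region of [v] be cut out by the half-planes above the
    tangents to the parabola [y = x ^+ 2] at the [t a], each lowered by some [h v a].
    When the [t a] are far apart no half-plane is redundant, so that inclusion, resp.
    inclusion in the interior, of the regions of [u] and [v] amounts to [h u a <= h v a],
    resp. [h u a < h v a], for all [a]; the interiors always meet, since all regions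
    are unbounded upwards. It remains to find such heights [h]. *)
Require Import Defs.
From mathcomp Require Import all_boot all_order all_algebra.
From mathcomp Require Import boolp classical_sets reals topology normedtype.
From mathcomp Require Import unstable filter convex interval_inference.
From mathcomp Require Import zify ring lra.

Set Implicit Arguments.
Unset Strict Implicit.
Unset Printing Implicit Defensive.

Import numFieldNormedType.Exports.

Local Open Scope classical_set_scope.

(** * Inclusion and [ntpp] in a topological space *)

Section proper_interior.
Variable T : topologicalType.
Implicit Types A B C : set T.

Lemma ntpp_sub A B : ntpp A B -> A `<=` B.
Proof. by move=> [AB _]; apply: subset_trans AB (@interior_subset _ _). Qed.

Lemma ntpp_irr A : ~ ntpp A A.
Proof. by move=> [_]; apply; exact: interior_subset. Qed.

Lemma sub_ntpp_trans A B C : A `<=` B -> ntpp B C -> ntpp A C.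
Proof.
move=> AB [BC CB]; split; first exact: subset_trans AB BC.
by move=> CA; apply: CB; exact: subset_trans CA AB.
Qed.

Lemma ntpp_sub_trans A B C : ntpp A B -> B `<=` C -> ntpp A C.
Proof.
move=> [AB BA] BC; have iBC := interiorS BC.
split; first exact: subset_trans AB iBC.
by move=> CA; apply: BA; exact: subset_trans iBC CA.
Qed.

(** [A] is closed and [B] is the closure of its interior. *)
Lemma sub_region_interior A B : region A -> region B -> interior B `<=` A -> B `<=` A.
Proof.
move=> [_ regA] [_ regB] /closure_subset; rewrite -regB.
suff /closure_id <- : closed A by [].
by rewrite regA; exact: closed_closure.
Qed.

(** Once interiors meet, each of the five relations is a Boolean combination of inclusions and
    [ntpp]. *)
Lemma rcc8_holds_transfer (T' : topologicalType) (r : rcc8) (a b : set T) (a' b' : set T') :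
  [set PO; TPP; TPPi; NTPP; NTPPi] r ->
  interior a' `&` interior b' !=set0 ->
  (a `<=` b <-> a' `<=` b') -> (b `<=` a <-> b' `<=` a') ->
  (ntpp a b <-> ntpp a' b') -> (ntpp b a <-> ntpp b' a') ->
  rcc8_holds r a b -> rcc8_holds r a' b'.
Proof.
move=> r_over meet /propext ab /propext ba /propext nab /propext nba.
case: r_over => [[[[->|->]|->]|->]|->] /=.
- by rewrite ab ba => -[].
- by rewrite /tpp -/(ntpp _ _) -/(ntpp _ _) /proper ab ba nab.
- by rewrite /tpp -/(ntpp _ _) -/(ntpp _ _) /proper ab ba nba.
- by rewrite nab.
- by rewrite nba.
Qed.

End proper_interior.

(** * Integer heights encoding a preorder and its strict relation *)

Section height.
Variables (V : finType) (le ll : rel V).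
Hypothesis le_refl : forall u, le u u.
Hypothesis ll_le : forall u v, ll u v -> le u v.
Hypothesis ll_irr : forall u, ~~ ll u u.
Hypothesis le_trans : forall u v w, le u v -> le v w -> le u w.
Hypothesis le_ll_trans : forall u v w, le u v -> ll v w -> ll u w.
Hypothesis ll_le_trans : forall u v w, ll u v -> le v w -> ll u w.

Definition rank v : nat := #|[pred w | ll w v]|.

(* At index [a] the height jumps twice, on entering the up-sets of [le a] and [ll a].
   The first jump detects [le a v]; making the height constant between the two jumps
   detects the failure of [ll a v]. Outside of that plateau [rank] makes the height
   strictly monotone for [ll], and two points of the plateau are never related by [ll]
   since [le a u] and [ll u v] give [ll a v]. *)
Definition height v a : nat :=
  if ll a v then #|V|.+2 + rank v
  else if le a v then #|V|.+1 else rank v.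

Lemma rank_le_card v : rank v <= #|V|.
Proof. exact: max_card. Qed.

Lemma rank_le u v : le u v -> rank u <= rank v.
Proof.
by move=> uv; apply/subset_leq_card/fintype.subsetP => w; rewrite !inE => /ll_le_trans; exact.
Qed.

Lemma rank_lt u v : ll u v -> rank u < rank v.
Proof.
move=> uv; apply/proper_card/properP; split.
  by apply/fintype.subsetP => w; rewrite !inE => wu; exact: ll_le_trans wu (ll_le uv).
by exists u; rewrite inE ?uv // (negbTE (ll_irr u)).
Qed.

Lemma height_bound v a : height v a <= #|V|.*2.+2.
Proof. by rewrite /height; have := rank_le_card v; do 2?case: ifP => _; lia. Qed.

(** For the converse, index [u] suffices: [height u u] is [#|V|.+1], above every rank, so
    [height v u] reaches it only if [le u v]. *)
Lemma height_leP u v : reflect (forall a, height u a <= height v a) (le u v).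
Proof.
apply: (iffP idP) => [uv a|/(_ u)]; last first.
  rewrite /height (negbTE (ll_irr u)) le_refl; have := rank_le_card v.
  by case: ifP => [/ll_le//|_]; case: ifP => //; lia.
have := rank_le uv; have := rank_le_card u; rewrite /height.
case: (boolP (ll a u)) => [/ll_le_trans/(_ uv) ->|_]; first by lia.
case: (boolP (le a u)) => [/le_trans/(_ uv) ->|_]; first by case: ifP; lia.
by do 2?case: ifP => _; lia.
Qed.

(** Index [u] decides again: only the branch [ll u v] exceeds the plateau value [#|V|.+1]. *)
Lemma height_ltP u v : reflect (forall a, height u a < height v a) (ll u v).
Proof.
apply: (iffP idP) => [uv a|/(_ u)]; last first.
  rewrite /height (negbTE (ll_irr u)) le_refl; have := rank_le_card v.
  by case: ifP => // _; case: ifP; lia.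
have := rank_lt uv; have := rank_le_card u; rewrite /height.
case: (boolP (ll a u)) => [/ll_le_trans/(_ (ll_le uv)) ->|_]; first by lia.
case: (boolP (le a u)) => [/le_ll_trans/(_ uv) ->|_]; first by lia.
by do 2?case: ifP => _; lia.
Qed.

End height.

(** * Regions bounded by lowered tangents to a parabola *)

Section tangent_region.
Import Order.TTheory GRing.Theory Num.Theory.
Local Open Scope ring_scope.

Variables (R : realType) (I : finType) (t : I -> R).
Implicit Types (p : 'rV[R]_2) (h g : I -> R).

(* [tangent_gap i p] is the height of the tangent to [y = x ^+ 2] at [x = t i]
   above [p]. *)
Definition tangent_gap i p : R :=
  2 * t i * p ord0 ord0 - t i ^+ 2 - p ord0 ord_max.

Definition tangent_region h : set 'rV[R]_2 := [set p | forall i, tangent_gap i p <= h i].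

Definition up : 'rV[R]_2 := delta_mx ord0 ord_max.

Lemma tangent_gap_up i p e : tangent_gap i (p + e *: up) = tangent_gap i p - e.
Proof. by rewrite /tangent_gap !mxE /=; ring. Qed.

Lemma continuous_tangent_gap i : continuous (tangent_gap i).
Proof.
move=> p; have coord j := @coord_continuous R 1 2 ord0 j p.
exact: cvgB (cvgB (cvgM (cvg_cst (2 * t i)) (coord ord0)) (cvg_cst (t i ^+ 2)))
  (coord ord_max).
Qed.

Lemma cvg_up p : (fun e : R => p + e *: up) @ (0 : R) --> p.
Proof.
rewrite -[X in _ --> X]addr0 -(scale0r up).
apply: cvgD; [exact: cvg_cst | exact: cvgZr_tmp cvg_id].
Qed.

(** Around an interior point, the region contains a point slightly lower, whose gaps are all larger.
    Conversely, finitely many strict inequalities between continuous functions define an open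
    set. *)
Lemma interior_tangent_region h :
  (tangent_region h)^° = [set p | forall i, tangent_gap i p < h i].
Proof.
apply/seteqP; split => p /= hp.
  move=> i; have /nbhs_ballP[e /= e0 eh] := cvg_up hp.
  have /eh/(_ i) : ball (0 : R) e (- (e / 2)).
    by rewrite -ball_normE /= sub0r opprK ger0_norm; lra.
  by rewrite tangent_gap_up; lra.
rewrite /interior /=.
have : \forall q \near p, forall i, tangent_gap i q < h i.
  apply: (@filter_forall _ _ (fun i q => tangent_gap i q < h i) _ (nbhs_filter p)) => i.
  exact: (cvgr_lt (tangent_gap i p) (@continuous_tangent_gap i p)).
by apply: filterS => q qh i; exact/ltW.
Qed.

Lemma tangent_region_convex h : convex_set (tangent_region h).
Proof.
move=> p q l; rewrite !inE => hp hq i.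
have -> : tangent_gap i (conv l p q) =
    l%:num * tangent_gap i p + (1 - l%:num) * tangent_gap i q.
  by rewrite /tangent_gap /conv /= !mxE /onem; ring.
have := hp i; have := hq i; have : 0 <= l%:num by [].
have : l%:num <= 1 by [].
move: (tangent_gap i p) (tangent_gap i q) (l%:num) => a b c; nra.
Qed.

Lemma interior_tangent_region_meet h g :
  (tangent_region h)^° `&` (tangent_region g)^° !=set0.
Proof.
have [p [hp gp]] : exists p,
    (forall i, tangent_gap i p < h i) /\ (forall i, tangent_gap i p < g i).
  (* Climbing by more than every [m i] brings each gap below both bounds, whatever their signs. *)
  pose m i := `|h i| + `|g i| + `|tangent_gap i 0|.
  exists (0 + (1 + \sum_i m i) *: up).
  have m_ge0 i : 0 <= m i by rewrite !addr_ge0.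
  have m_le i : m i <= \sum_i m i by rewrite (bigD1 i)//= lerDl sumr_ge0.
  by split=> i; rewrite tangent_gap_up; move: (m_le i); rewrite {1}/m;
    have := ler_norm (- h i); have := ler_norm (- g i);
    have := ler_norm (tangent_gap i 0); rewrite !normrN;
    have := normr_ge0 (h i); have := normr_ge0 (g i); lra.
by exists p; rewrite !interior_tangent_region.
Qed.

Lemma tangent_region_region h : region (tangent_region h).
Proof.
have [p [hp _]] := interior_tangent_region_meet h h.
split; first by exists p; exact: interior_subset hp.
apply/seteqP; split => [q hq A qA|].
  (* Points slightly above [q] have strictly smaller gaps, hence are interior. *)
  have /nbhs_ballP[e /= e0 eA] := cvg_up qA.
  exists (q + (e / 2) *: up); split.
    by rewrite interior_tangent_region => i /=; rewrite tangent_gap_up; move: (hq i); lra.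
  by apply: eA; rewrite -ball_normE /= sub0r normrN ger0_norm; lra.
move=> q /(closure_subset (@interior_subset _ _)) hq i.
rewrite leNgt; apply/negP => hi.
have : \forall r \near q, h i < tangent_gap i r.
  exact: (cvgr_gt (tangent_gap i q) (@continuous_tangent_gap i q)).
by move/hq => [r [/(_ i) + ]]; rewrite leNgt => /negbTE ->.
Qed.

Lemma tangent_gap_attained h i :
  (forall j, h i <= (t i - t j) ^+ 2 + h j) ->
  exists2 p, tangent_region h p & tangent_gap i p = h i.
Proof.
(* [p] lies [h i] below the tangency point at [t i], where tangent [j] runs [(t i - t j) ^+ 2] below
   the parabola. *)
move=> hi; pose p : 'rV[R]_2 := \row_j (if j == ord0 then t i else t i ^+ 2 - h i).
have gapE j : tangent_gap j p = h i - (t i - t j) ^+ 2.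
  by rewrite /tangent_gap !mxE /=; ring.
exists p => [j|]; last by rewrite gapE subrr; ring.
by rewrite gapE; have := hi j; lra.
Qed.

Lemma sub_tangent_region h g :
  (forall i j, h i <= (t i - t j) ^+ 2 + h j) ->
  tangent_region h `<=` tangent_region g <-> forall i, h i <= g i.
Proof.
move=> hh; split=> [hg i|hg p hp i]; last exact: le_trans (hp i) (hg i).
by have [p /hg/(_ i) + <-] := tangent_gap_attained (hh i).
Qed.

Lemma sub_interior_tangent_region h g :
  (forall i j, h i <= (t i - t j) ^+ 2 + h j) ->
  tangent_region h `<=` (tangent_region g)^° <-> forall i, h i < g i.
Proof.
move=> hh; rewrite interior_tangent_region.
split=> [hg i|hg p hp i]; last exact: le_lt_trans (hp i) (hg i).
by have [p /hg/(_ i) + <-] := tangent_gap_attained (hh i).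
Qed.

End tangent_region.

(** * Realisation in the plane *)

Section convex_realization.
Import Order.TTheory GRing.Theory Num.Theory.
Local Open Scope ring_scope.

Lemma sqr_natrB_ge1 (K : realDomainType) (m n : nat) :
  m != n -> 1 <= (m%:R - n%:R) ^+ 2 :> K.
Proof.
case: (ltngtP m n) => // mn _; first rewrite -sqrrN opprB.
  by rewrite -natrB ?(ltnW mn)// -natrX ler1n sqrn_gt0 subn_gt0.
by rewrite -natrB ?(ltnW mn)// -natrX ler1n sqrn_gt0 subn_gt0.
Qed.

Variables (R : realType) (V : finType) (T : topologicalType) (S : V -> set T).

Let le u v := `[< S u `<=` S v >].
Let ll u v := `[< ntpp (S u) (S v) >].
Let h v a : R := (height le ll v a)%:R.

(** The spacing is the bound of [height_bound], so squared distances between distinct sites dominate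
    all heights. *)
Let site (i : V) : R := ((#|V|.*2.+2)%N * enum_rank i)%:R.

Let le_refl u : le u u. Proof. exact/asboolP. Qed.
Let ll_le u v : ll u v -> le u v.
Proof. by move=> /asboolP/ntpp_sub uv; exact/asboolP. Qed.
Let ll_irr u : ~~ ll u u.
Proof. by apply/asboolP/ntpp_irr. Qed.
Let le_trans u v w : le u v -> le v w -> le u w.
Proof. by move=> /asboolP uv /asboolP vw; apply/asboolP; exact: subset_trans uv vw. Qed.
Let le_ll_trans u v w : le u v -> ll v w -> ll u w.
Proof. by move=> /asboolP uv /asboolP vw; apply/asboolP; exact: sub_ntpp_trans uv vw. Qed.
Let ll_le_trans u v w : ll u v -> le v w -> ll u w.
Proof. by move=> /asboolP uv /asboolP vw; apply/asboolP; exact: ntpp_sub_trans uv vw. Qed.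

Let sub_heightP u v : S u `<=` S v <-> forall i, h u i <= h v i.
Proof.
have heightP := height_leP le_refl ll_le ll_irr le_trans ll_le_trans u v.
split=> [uv i|uv]; first by rewrite ler_nat; apply/heightP/asboolP.
by apply/asboolP/heightP => i; have := uv i; rewrite ler_nat.
Qed.

Let ntpp_heightP u v : ntpp (S u) (S v) <-> forall i, h u i < h v i.
Proof.
have heightP := height_ltP le_refl ll_le ll_irr le_ll_trans ll_le_trans u v.
split=> [uv i|uv]; first by rewrite ltr_nat; apply/heightP/asboolP.
by apply/asboolP/heightP => i; have := uv i; rewrite ltr_nat.
Qed.

Let h_separated v i j : h v i <= (site i - site j) ^+ 2 + h v j.
Proof.
have [->|ij] := eqVneq i j; first by rewrite subrr expr0n add0r.
apply: (@Order.POrderTheory.le_trans _ _ ((#|V|.*2.+2)%N%:R ^+ 2 : R)).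
  rewrite -natrX ler_nat; apply: leq_trans (height_bound le ll v i) _.
  by rewrite leq_pmulr.
rewrite -[leLHS]addr0; apply: lerD; last by rewrite ler0n.
rewrite /site !natrM -mulrBr exprMn ler_peMr ?exprn_ge0 ?ler0n//.
apply: sqr_natrB_ge1.
by apply: contra_neq ij => /val_inj/enum_rank_inj.
Qed.

Lemma convex_realization : exists S' : V -> set 'rV[R]_2,
  [/\ forall v, region (S' v) /\ convex_set (S' v),
      forall u v, (S' u)^° `&` (S' v)^° !=set0,
      forall u v, S u `<=` S v <-> S' u `<=` S' v &
      forall u v, ntpp (S u) (S v) <-> ntpp (S' u) (S' v)].
Proof.
exists (fun v => tangent_region site (h v)).
split=> [v|u v|u v|u v].
- by split; [exact: tangent_region_region | exact: tangent_region_convex].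
- exact: interior_tangent_region_meet.
- by rewrite sub_heightP sub_tangent_region.
- rewrite ntpp_heightP -(sub_interior_tangent_region _ (h_separated u)).
  (* Properness: otherwise regularity would give the reverse inclusion, against the strict
     inequality of heights at index [u]. *)
  split=> [uv|[]//]; split=> // /(sub_region_interior (tangent_region_region _ _)).
  move=> /(_ (tangent_region_region _ _)).
  move/(sub_interior_tangent_region _ (h_separated u))/(_ u) : uv => uv.
  by rewrite sub_tangent_region// => /(_ u); rewrite leNgt uv.
Qed.

End convex_realization.

Unset Implicit Arguments.

Theorem proposition9 (R : realType) (V : finType) (N : network V)
    (Nconsistent : consistent R N)
    (Natomic : atomic N)
    (Nover : network_over [set PO; TPP; TPPi; NTPP; NTPPi] N) :
  exists S : V -> set 'rV[R]_2, convex_solution N S.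
Proof.
have [n [_ [S [_ SN]]]] := Nconsistent.
have [S' [S'reg S'meet S'le S'll]] := convex_realization R S.
exists S'; split; last by move=> v; have [] := S'reg v.
split=> [v|c Nc]; first by have [] := S'reg v.
(* The base relation [r] realised by [S] is the one kept for [S']. *)
have [r cr Sr] := SN c Nc; exists r => //.
by apply: rcc8_holds_transfer Sr => //; exact: Nover cr.
Qed.
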